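(* Let $k$ be an algebraically closed field of characteristic zero, let $n\geq 3$, and let $N$ be the nilradical of the parabolic subalgebra $P$ of type $(1,1,n-2)$ inside $\mathfrak{sl}(n)=\mathfrak{sl}(n,k)$. Then $$N\text{ is coregular}\iff n\leq 4\iff i(N)\leq 3.$$
   Context: The parabolic subalgebra of type $(1,1,n-2)$ is the subalgebra of block upper triangular matrices with diagonal blocks of sizes $1,1,n-2$. Here $N$ denotes the span of the elementary matrices $E_{12},E_{13},\ldots,E_{1n},E_{23},\ldots,E_{2n}$ (the strictly block upper triangular matrices). For a finite-dimensional Lie algebra $\mathfrak{g}$, $Y(\mathfrak{g})=S(\mathfrak{g})^{\mathfrak{g}}$ is the algebra of invariants of the adjoint action on the symmetric algebra; $\mathfrak{g}$ is coregular if $Y(\mathfrak{g})$ is a polynomial algebra over $k$. The index is $i(\mathfrak{g})=\min_{\xi\in\mathfrak{g}^*}\dim\{x\in\mathfrak{g}\mid\xi([x,y])=0\ \forall y\in\mathfrak{g}\}$. *)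

(* Defs.v *)
From HB Require Import structures.
From mathcomp Require Import all_boot all_order all_algebra.
From mathcomp Require Import boolp mpoly ring zify.

Set Implicit Arguments.
Unset Strict Implicit.
Unset Printing Implicit Defensive.

Import GRing.Theory.
Local Open Scope ring_scope.

HB.mixin Record Vector_isLie (k : fieldType) L of Vector k L := {
  lie : L -> L -> L;
  lieDl : forall x y z, lie (x + y) z = lie x z + lie y z;
  lieDr : forall x y z, lie x (y + z) = lie x y + lie x z;
  lieZl : forall a x y, lie (a *: x) y = a *: lie x y;
  lieZr : forall a x y, lie x (a *: y) = a *: lie x y;
  liexx : forall x, lie x x = 0;
  lie_jacobi : forall x y z,
    lie x (lie y z) + lie y (lie z x) + lie z (lie x y) = 0
}.

#[short(type="lieAlgType")]
HB.structure Definition LieAlg (k : fieldType) :=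
  { L of Vector k L & Vector_isLie k L }.

Section General.
Variables (k : fieldType) (L : lieAlgType k).
Implicit Types (x y z : L) (U V P I N : {vspace L}).

Lemma lie_is_linear_l y : linear (fun x => lie x y).
Proof. by move=> a u v; rewrite lieDl lieZl. Qed.

Lemma lie_is_linear_r x : linear (lie x).
Proof. by move=> a u v; rewrite lieDr lieZr. Qed.

HB.instance Definition _ x := GRing.isLinear.Build k L L _ (lie x)
  (lie_is_linear_r x).

Lemma lieC x y : lie x y = - lie y x.
Proof.
apply/eqP; rewrite -addr_eq0; apply/eqP.
by have := liexx (x + y); rewrite lieDl !lieDr !liexx add0r addr0.
Qed.

Definition lie_form (xi : 'Hom(L, k^o)) (x : L) : 'Hom(L, k^o) :=
  linfun (fun y => xi (lie x y)).

Definition form_radical (xi : 'Hom(L, k^o)) : {vspace L} :=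
  lker (linfun (lie_form xi)).

Lemma form_is_linear (xi : 'Hom(L, k^o)) x : linear (fun y => xi (lie x y)).
Proof. by move=> a u v; rewrite linearP /= linearP. Qed.

Lemma lie_formE (xi : 'Hom(L, k^o)) x y : lie_form xi x y = xi (lie x y).
Proof.
pose l := GRing.isLinear.Build k L k^o _ _ (form_is_linear xi x).
pose f : {linear L -> k^o} := HB.pack (fun y => xi (lie x y)) l.
by rewrite /lie_form (lfunE f).
Qed.

Lemma mem_form_radical (xi : 'Hom(L, k^o)) x :
  (x \in form_radical xi) <-> (forall y, xi (lie x y) = 0).
Proof.
have lin : linear (lie_form xi).
  move=> a u v; apply/lfunP => y.
  by rewrite add_lfunE scale_lfunE !lie_formE lieDl lieZl linearP.
pose l := GRing.isLinear.Build k L 'Hom(L, k^o) _ _ lin.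
pose f : {linear L -> 'Hom(L, k^o)} := HB.pack (lie_form xi) l.
rewrite memv_ker (lfunE f) /=; split=> [/eqP e y|e].
  by rewrite -lie_formE e lfunE.
by apply/eqP/lfunP => y; rewrite lie_formE e lfunE.
Qed.

Lemma index_witness :
  exists d, `[< exists xi : 'Hom(L, k^o), \dim (form_radical xi) = d >].
Proof. by exists (\dim (form_radical 0)); apply/asboolP; exists 0. Qed.

Definition lie_index : nat := ex_minn index_witness.

(* S(L) is realised as the polynomial ring on the basis [vbasis fullv] of L; *)
(* [symalg_universal] is its universal property.                             *)

Notation d := (\dim {:L}).

Definition symalg := {mpoly k[d]}.

Definition sym_inj (x : L) : symalg :=
  \sum_(i < d) coord (vbasis {:L}) i x *: 'X_i.

Lemma sym_inj_is_linear : linear sym_inj.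
Proof.
move=> a u v; rewrite /sym_inj scaler_sumr -big_split /=.
by apply: eq_bigr => i _; rewrite linearP scalerDl scalerA.
Qed.

HB.instance Definition _ := GRing.isLinear.Build k L {mpoly k[d]} _ sym_inj
  sym_inj_is_linear.

Lemma symalg_universal (A : comAlgType k) (f : {linear L -> A}) :
  exists2 g : {lrmorphism {mpoly k[d]} -> A},
    (forall x, g (sym_inj x) = f x) &
    forall g' : {lrmorphism {mpoly k[d]} -> A},
      (forall x, g' (sym_inj x) = f x) -> g' =1 g.
Proof.
pose h (i : 'I_d) := f (vbasis {:L})`_i.
have gZ : scalable (mmap (in_alg A) h : {mpoly k[d]} -> A).
  by move=> a p; rewrite mmapZ mulr_algl.
pose g : {lrmorphism {mpoly k[d]} -> A} := HB.pack
  (mmap (in_alg A) h : {mpoly k[d]} -> A)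
  (GRing.RMorphism.on (mmap (in_alg A) h : {mpoly k[d]} -> A))
  (GRing.isScalable.Build k {mpoly k[d]} A _ _ gZ).
have gX i : g 'X_i = h i by rewrite /g /= mmapX mmap1U.
exists g => [x|g' g'E p].
  rewrite {2}(coord_vbasis (memvf x)) !linear_sum; apply: eq_bigr => i _.
  by rewrite !linearZ; congr (_ *: _); apply: gX.
have injX (i : 'I_d) : sym_inj (vbasis {:L})`_i = 'X_i.
  rewrite /sym_inj (bigD1 i) //= coord_free ?(basis_free (vbasisP _)) // eqxx.
  rewrite scale1r big1 ?addr0 // => j ji.
  by rewrite coord_free ?(basis_free (vbasisP _)) // eq_sym (negPf ji) scale0r.
rewrite (mpolyE p) !linear_sum; apply: eq_bigr => m _; rewrite !linearZ /=.
rewrite mpolyXE_id !rmorph_prod; congr (_ *: _).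
apply: eq_bigr => i _; rewrite !rmorphXn; congr (_ ^+ _).
transitivity (h i); last by symmetry; apply: gX.
exact: etrans (congr1 g' (esym (injX i))) (g'E _).
Qed.

(* The unique derivation of S(L) extending [lie x] : L -> L. *)
Definition sym_ad (x : L) (p : symalg) : symalg :=
  \sum_(i < d) sym_inj (lie x (vbasis {:L})`_i) * p^`M(i).

Lemma sym_ad_is_linear x : linear (sym_ad x).
Proof.
move=> a p q; rewrite /sym_ad scaler_sumr -big_split /=.
by apply: eq_bigr => i _; rewrite linearP mulrDr scalerAr.
Qed.

Lemma sym_adM x p q : sym_ad x (p * q) = sym_ad x p * q + p * sym_ad x q.
Proof.
rewrite /sym_ad mulr_suml mulr_sumr -big_split /=; apply: eq_bigr => i _.
by rewrite mderivM mulrDr; congr (_ + _); [apply: mulrA | apply: mulrCA].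
Qed.

Lemma sym_ad_inj x y : sym_ad x (sym_inj y) = sym_inj (lie x y).
Proof.
rewrite {2}(coord_vbasis (memvf y)) linear_sum linear_sum /= /sym_ad.
apply: eq_bigr => i _; rewrite [lie x (_ *: _)]linearZ linearZ /= {2}/sym_inj.
rewrite linear_sum /= (bigD1 i) //= big1 => [|j ji]; last first.
  by rewrite linearZ /= mderivX mnm1E (negPf ji) scale0r scaler0.
rewrite addr0 linearZ /= mderivX mnm1E eqxx scale1r.
have -> : (U_(i) - U_(i) = 0)%MM by apply/mnmP => j; rewrite mnmBE mnm0E subnn.
by rewrite mpolyX0 -scalerAr mulr1.
Qed.

Definition sym_invariant (p : symalg) : Prop := forall x : L, sym_ad x p = 0.

(* Y(L), the algebra of invariants, is isomorphic as a k-algebra to some     *)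
(* k[X_1, ..., X_m].                                                         *)
Definition coregular : Prop :=
  exists (m : nat) (phi : {lrmorphism {mpoly k[m]} -> {mpoly k[d]}}),
    injective phi /\ (forall p, sym_invariant p <-> exists q, phi q = p).

Definition subalgebra U : Prop :=
  forall x y, x \in U -> y \in U -> lie x y \in U.

Definition ideal_of P I : Prop :=
  (I <= P)%VS /\ (forall x y, x \in P -> y \in I -> lie x y \in I).

Definition lie_prod U V : {vspace L} :=
  <<[seq lie u v | u <- vbasis U, v <- vbasis V]>>%VS.

Definition nilpotent U : Prop := exists m, iter m (lie_prod U) U = 0%VS.

Definition nilradical_of P N : Prop :=
  [/\ ideal_of P N, nilpotent N &
      forall I, ideal_of P I -> nilpotent I -> (I <= N)%VS].

Lemma mem_lie_prod U V u v : u \in U -> v \in V -> lie u v \in lie_prod U V.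
Proof.
move=> uU vV; rewrite (coord_vbasis uU) (coord_vbasis vV) linear_sum /=.
apply: rpred_sum => j _; rewrite linearZ /=; apply: rpredZ.
rewrite lieC rpredN linear_sum; apply: rpred_sum => i _ /=.
rewrite linearZ /= rpredZ // lieC rpredN memv_span //.
by apply: allpairs_f; apply: mem_nth; rewrite size_tuple.
Qed.

Lemma lie_prod_sub U V (W : {vspace L}) : (forall u v, u \in U -> v \in V -> lie u v \in W) ->
  (lie_prod U V <= W)%VS.
Proof.
move=> h; apply/span_subvP => _ /allpairsP[[u v] [/= uU vV ->]].
by apply: h; apply: vbasis_mem.
Qed.

End General.

Section Subalgebra.
Variables (k : fieldType) (L : lieAlgType k) (U : {vspace L}).

Definition subLie of subalgebra U := subvs_of U.

Variable hU : subalgebra U.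

HB.instance Definition _ := Vector.on (subLie hU).

Definition sub_lie (x y : subLie hU) : subLie hU :=
  vsproj U (lie (vsval x) (vsval y)).

Lemma vsval_lie x y : vsval (sub_lie x y) = lie (vsval x) (vsval y).
Proof. by rewrite vsprojK // hU ?subvsP. Qed.

Fact sub_lieDl x y z : sub_lie (x + y) z = sub_lie x z + sub_lie y z.
Proof. by apply: subvs_inj; rewrite linearD /= !vsval_lie linearD lieDl. Qed.
Fact sub_lieDr x y z : sub_lie x (y + z) = sub_lie x y + sub_lie x z.
Proof. by apply: subvs_inj; rewrite linearD /= !vsval_lie linearD. Qed.
Fact sub_lieZl a x y : sub_lie (a *: x) y = a *: sub_lie x y.
Proof. by apply: subvs_inj; rewrite linearZ /= !vsval_lie linearZ lieZl. Qed.
Fact sub_lieZr a x y : sub_lie x (a *: y) = a *: sub_lie x y.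
Proof. by apply: subvs_inj; rewrite linearZ /= !vsval_lie linearZ. Qed.
Fact sub_liexx x : sub_lie x x = 0.
Proof. by apply: subvs_inj; rewrite vsval_lie liexx linear0. Qed.
Fact sub_lie_jacobi x y z :
  sub_lie x (sub_lie y z) + sub_lie y (sub_lie z x) + sub_lie z (sub_lie x y)
  = 0.
Proof.
by apply: subvs_inj; rewrite !linearD linear0 /= !vsval_lie lie_jacobi.
Qed.

HB.instance Definition _ := Vector_isLie.Build k (subLie hU)
  sub_lieDl sub_lieDr sub_lieZl sub_lieZr sub_liexx sub_lie_jacobi.

End Subalgebra.

Section MatrixLie.
Variables (k : fieldType) (n : nat).
Implicit Types x y z : 'M[k]_n.

Definition mx_lie x y := x *m y - y *m x.

Fact mx_lieDl x y z : mx_lie (x + y) z = mx_lie x z + mx_lie y z.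
Proof. by rewrite /mx_lie mulmxDl mulmxDr opprD addrACA. Qed.
Fact mx_lieDr x y z : mx_lie x (y + z) = mx_lie x y + mx_lie x z.
Proof. by rewrite /mx_lie mulmxDl mulmxDr opprD addrACA. Qed.
Fact mx_lieZl a x y : mx_lie (a *: x) y = a *: mx_lie x y.
Proof. by rewrite /mx_lie -scalemxAl -scalemxAr scalerBr. Qed.
Fact mx_lieZr a x y : mx_lie x (a *: y) = a *: mx_lie x y.
Proof. by rewrite /mx_lie -scalemxAl -scalemxAr scalerBr. Qed.
Fact mx_liexx x : mx_lie x x = 0.
Proof. exact: subrr. Qed.
Fact mx_lie_jacobi x y z :
  mx_lie x (mx_lie y z) + mx_lie y (mx_lie z x) + mx_lie z (mx_lie x y) = 0.
Proof.
rewrite /mx_lie !mulmxBl !mulmxBr !mulmxA !opprB.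
move: (x *m y *m z) (x *m z *m y) (y *m x *m z) (y *m z *m x) (z *m x *m y)
  (z *m y *m x) => a b c d e f.
apply/matrixP => i j; rewrite !mxE.
move: (a i j) (b i j) (c i j) (d i j) (e i j) (f i j) => {}a {}b {}c {}d {}e {}f.
by ring.
Qed.

HB.instance Definition _ := Vector_isLie.Build k 'M[k]_n
  mx_lieDl mx_lieDr mx_lieZl mx_lieZr mx_liexx mx_lie_jacobi.

Lemma mx_lieE x y : lie x y = x *m y - y *m x.
Proof. by []. Qed.

Definition elem_span (C : rel 'I_n) : {vspace 'M[k]_n} :=
  <<[seq delta_mx ij.1 ij.2 | ij : 'I_n * 'I_n in [pred ij | C ij.1 ij.2]]>>%VS.

Lemma elem_spanP (C : rel 'I_n) x :
  (x \in elem_span C) <-> (forall i j, ~~ C i j -> x i j = 0).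
Proof.
split=> [xC i j nC|x0].
  rewrite (coord_span (X := in_tuple _) xC) summxE big1 // => u _; rewrite mxE.
  have /= : (in_tuple [seq (delta_mx ij.1 ij.2 : 'M[k]_n)
      | ij : 'I_n * 'I_n in [pred ij | C ij.1 ij.2]])`_u \in _ := mem_nth _ (ltn_ord u).
  case/imageP => -[a b] /=; rewrite inE /= => Cab ->; rewrite mxE.
  case: eqP => [ia|]; case: eqP => [jb|]; rewrite ?mulr0 //.
  by rewrite ia jb Cab in nC.
rewrite (matrix_sum_delta x); apply: rpred_sum => i _; apply: rpred_sum => j _.
have [Cij|/x0->] := boolP (C i j); last by rewrite scale0r rpred0.
by rewrite rpredZ // memv_span //; apply/imageP; exists (i, j).
Qed.

Definition mx_sl : {vspace 'M[k]_n} :=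
  lker (linfun (mxtrace : 'M[k]_n -> k^o)).

Lemma mem_sl x : (x \in mx_sl) = (\tr x == 0).
Proof. by rewrite memv_ker lfunE. Qed.

(* Row i (counted from 0) lies in the block of index [minn i 2] for the block *)
(* sizes (1, 1, n - 2).                                                       *)
Definition parabolic112 : {vspace 'M[k]_n} :=
  (elem_span (fun i j => minn i 2 <= minn j 2)%N :&: mx_sl)%VS.

(* With indices counted from 1, the span of E_12, ..., E_1n, E_23, ..., E_2n. *)
Definition nil112 : {vspace 'M[k]_n} :=
  elem_span (fun i j => (i < 2) && (i < j))%N.

Lemma nil112_ideal : ideal_of parabolic112 nil112.
Proof.
split.
  apply/subvP => x /elem_spanP xN; rewrite memv_cap mem_sl; apply/andP; split.
    by apply/elem_spanP => i j ij; apply: xN; lia.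
  by rewrite /mxtrace big1 // => i _; apply: xN; lia.
move=> x y; rewrite memv_cap => /andP[/elem_spanP xP _] /elem_spanP yN.
apply/elem_spanP => i j ij; rewrite mx_lieE !mxE !big1 ?subr0 // => l _.
  have [il|il] := boolP ((i < 2) && (i < l))%N.
    by rewrite xP ?mulr0 //; lia.
  by rewrite yN // mul0r.
have [il|il] := boolP ((l < 2) && (l < j))%N.
  by rewrite xP ?mul0r //; lia.
by rewrite yN // mulr0.
Qed.

Lemma nil112_subalg : subalgebra nil112.
Proof.
have [/subvP sub h] := nil112_ideal.
by move=> x y xN yN; apply: h => //; apply: sub.
Qed.

Lemma nil112_nilpotent : nilpotent nil112.
Proof.
exists 2; apply/eqP; rewrite -subv0 /=.
pose W := elem_span (fun i j => (i < 1) && (1 < j))%N.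
apply: (@subv_trans _ _ (lie_prod nil112 W)).
  apply: lie_prod_sub => u v uN vN; apply: mem_lie_prod => //.
  apply: (subvP _) vN; apply: lie_prod_sub => {uN}u {}v.
  move=> /elem_spanP uN /elem_spanP vN; apply/elem_spanP => i j ij.
  rewrite mx_lieE !mxE !big1 ?subr0 // => l _.
    have [il|il] := boolP ((i < 2) && (i < l))%N; last by rewrite vN // mul0r.
    by rewrite uN ?mulr0 //; lia.
  have [il|il] := boolP ((i < 2) && (i < l))%N; last by rewrite uN // mul0r.
  by rewrite vN ?mulr0 //; lia.
apply: lie_prod_sub => u v /elem_spanP uN /elem_spanP vN; rewrite memv0.
apply/eqP/matrixP => i j; rewrite mx_lieE !mxE !big1 ?subr0 // => l _.
  have [il|il] := boolP ((i < 1) && (1 < l))%N; last by rewrite vN // mul0r.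
  by rewrite uN ?mulr0 //; lia.
have [il|il] := boolP ((i < 2) && (i < l))%N; last by rewrite uN // mul0r.
by rewrite vN ?mulr0 //; lia.
Qed.

Lemma nilpotent_iter (I : {vspace 'M[k]_n}) x y : nilpotent I ->
  x \in I -> y \in I -> exists m, iter m (lie x) y = 0.
Proof.
case=> m Im xI yI; exists m; apply/eqP; rewrite -memv0 -Im.
by elim: m {Im} => //= m IH; apply: mem_lie_prod.
Qed.

Lemma nilpotent_eigen (I : {vspace 'M[k]_n}) x y c : nilpotent I ->
  x \in I -> y \in I -> lie x y = c *: y -> y != 0 -> c = 0.
Proof.
move=> In xI yI e y0; have [m] := nilpotent_iter In xI yI.
have -> : iter m (lie x) y = c ^+ m *: y.
  elim: m => [|m IH] /=; first by rewrite scale1r.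
  by rewrite IH linearZ /= e scalerA exprSr.
by move/eqP; rewrite scaler_eq0 (negPf y0) orbF expf_eq0 => /andP[_ /eqP].
Qed.

End MatrixLie.

Lemma nil112_nilradical (k : fieldType) (n : nat) :
  [pchar k] =i pred0 -> (2 < n)%N ->
  nilradical_of (parabolic112 k n) (nil112 k n).
Proof.
move=> ch n2; split; [exact: nil112_ideal | exact: nil112_nilpotent |].
have chn m : (m.+1%:R : k) != 0.
  by have /pcharf0P -> := ch.
move=> I [/subvP IP Iid] In; apply/subvP => x xI.
have xP' := IP x xI; move: (xP'); rewrite memv_cap mem_sl => /andP[xP trx].
move/elem_spanP in xP.
have liePr y z : y \in I -> z \in parabolic112 k n -> lie y z \in I.
  by move=> yI zP; rewrite lieC rpredN; apply: Iid.
have dP (a b : 'I_n) : a != b -> (minn a 2 <= minn b 2)%N ->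
    delta_mx a b \in parabolic112 k n.
  move=> ab le; rewrite memv_cap mem_sl; apply/andP; split.
    apply/elem_spanP => i j ij; rewrite mxE.
    by case: eqP => [ia|] //; case: eqP => [jb|] //; rewrite ia jb le in ij.
  rewrite /mxtrace big1 // => i _; rewrite mxE.
  by case: eqP => [ia|] //; case: eqP => [ib|] //; rewrite -ia -ib eqxx in ab.
have dd (a b c e : 'I_n) : delta_mx a b *m delta_mx c e =
    (b == c)%:R *: (delta_mx a e : 'M[k]_n).
  case: (eqVneq b c) => [->|bc]; first by rewrite mul_delta_mx scale1r.
  by rewrite mul_delta_mx_0 // scale0r.
have dmd (a b : 'I_n) (z : 'M[k]_n) :
    delta_mx b a *m z *m delta_mx b a = z a b *: delta_mx b a.
  apply/matrixP => i j; rewrite !mxE (bigD1 b) //= big1 ?addr0; last first.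
    by move=> l lb; rewrite [delta_mx _ _ _ _]mxE (negPf lb) mulr0.
  rewrite !mxE (bigD1 a) //= big1 ?addr0; last first.
    by move=> l la; rewrite mxE (negPf la) andbF mul0r.
  by rewrite !mxE !eqxx andbT; case: eqP; case: eqP; rewrite ?mul1r ?mul0r ?mulr0 ?mulr1.
have off (a b : 'I_n) : (1 < a)%N -> (1 < b)%N -> a != b -> x a b = 0.
  move=> a1 b1 ab; apply/eqP/negPn/negP => xab.
  pose E : 'M[k]_n := delta_mx b a; pose F : 'M[k]_n := delta_mx a b.
  have EP : E \in parabolic112 k n by apply: dP; [rewrite eq_sym | lia].
  have FP : F \in parabolic112 k n by apply: dP => //; lia.
  have EE : E *m E = 0 by rewrite dd (negPf ab) scale0r.
  have eq2 : lie (lie x E) E = (- (2%:R * x a b)) *: E.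
    rewrite !mx_lieE mulmxBl mulmxBr !mulmxA -(mulmxA x) EE mulmx0 mul0mx.
    by rewrite subr0 sub0r dmd -opprD -scalerDl -scaleNr mulr_natl mulr2n.
  have EI : E \in I.
    have := liePr _ _ (liePr _ _ xI EP) EP; rewrite eq2 rpredZeq.
    by rewrite oppr_eq0 mulf_eq0 (negPf xab) (negPf (chn 1)).
  have HI : lie E F \in I by apply: liePr.
  have eH : lie (lie E F) E = 2%:R *: E.
    rewrite !mx_lieE mulmxBl mulmxBr -!mulmxA EE !mulmxA EE !dd !eqxx !mulmx0.
    rewrite !scale1r !dd !eqxx !scale1r mul0mx subr0 sub0r opprK.
    by rewrite scaler_nat mulr2n.
  have E0 : E != 0.
    by apply/eqP => /matrixP/(_ b a)/eqP; rewrite !mxE !eqxx oner_eq0.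
  by have /eqP := nilpotent_eigen In HI EI eH E0; rewrite (negPf (chn 1)).
have diag (a b : 'I_n) : (a < 2)%N -> (b : nat) = a.+1 \/ (a = 1 :> nat) /\ (1 < b)%N ->
    x a a = x b b.
  move=> a2 ab; pose y0 : 'M[k]_n := delta_mx a b.
  have [/subvP NP Nid] := nil112_ideal k n.
  have yN : y0 \in nil112 k n.
    apply/elem_spanP => i j ij; rewrite mxE.
    case: eqP => [ia|] //; case: eqP => [jb|] //; subst i j.
    by move: ij; rewrite a2 /=; lia.
  have ent m : iter m (lie x) y0 \in nil112 k n /\
      iter m (lie x) y0 a b = (x a a - x b b) ^+ m.
    elim: m => [|m [IHN IHe]] /=.
      by split=> //; rewrite mxE !eqxx.
    split; first exact: Nid.
    set y := iter m _ _ in IHN IHe *; move/elem_spanP in IHN.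
    rewrite mx_lieE !mxE (bigD1 a) //= big1 ?addr0; last first.
      move=> l /eqP la; have {}la : (l : nat) <> a by move=> e; apply/la/val_inj.
      have [il|il] := boolP ((l < 2) && (l < b))%N; last by rewrite IHN ?mulr0.
      by rewrite xP ?mul0r //; lia.
    rewrite (bigD1 b) //= big1 ?addr0; last first.
      move=> l /eqP lb; have {}lb : (l : nat) <> b by move=> e; apply/lb/val_inj.
      have [il|il] := boolP ((a < 2) && (a < l))%N; last by rewrite IHN ?mul0r.
      have [lb2|lb2] := boolP ((1 < l) && (1 < b))%N.
        rewrite off ?mulr0 //; [lia | lia |].
        by apply/eqP => e; apply: lb; rewrite e.
      by rewrite xP ?mulr0 //; lia.
    by rewrite -/y IHe exprS mulrBl [_ * x b b]mulrC.
  have [m] := nilpotent_iter In xI (liePr _ _ xI (NP _ yN)).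
  rewrite -iterSr => /matrixP/(_ a b); have [_ ->] := ent m.+1; rewrite mxE.
  by move/eqP; rewrite expf_eq0 subr_eq0 => /andP[_ /eqP].
have n0 : (0 < n)%N by lia.
have n1 : (1 < n)%N by lia.
pose o0 := Ordinal n0; pose o1 := Ordinal n1.
have x01 : x o0 o0 = x o1 o1 by apply: diag => //; left.
have xd i : x i i = x o1 o1.
  have [i2|i2] := ltnP 1 i; first by symmetry; apply: diag => //; right.
  have [i0|i0] := posnP i; first by rewrite (_ : i = o0) //; apply: val_inj.
  by rewrite (_ : i = o1) //; apply: val_inj => /=; lia.
have xd0 i : x i i = 0.
  move: trx; rewrite /mxtrace (eq_bigr (fun=> x o1 o1)) //.
  rewrite sumr_const card_ord -mulr_natl mulf_eq0.
  have -> : (n%:R == 0 :> k) = false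
    by rewrite (pcharf0P k).1 ?ch //; lia.
  by rewrite xd => /eqP.
apply/elem_spanP => i j ij.
have [/val_inj->//|/eqP ne] := eqVneq (i : nat) j.
have [/andP[i1 j1]|ij1] := boolP ((1 < i) && (1 < j))%N.
  by apply: off => //; apply/eqP => e; apply: ne; rewrite e.
by apply: xP; lia.
Qed.

(* Main.v *)
Require Import Defs.
From HB Require Import structures.
From mathcomp Require Import all_boot all_order all_algebra.
From mathcomp Require Import boolp mpoly ring zify.

Set Implicit Arguments.
Unset Strict Implicit.
Unset Printing Implicit Defensive.

Import GRing.Theory.
Local Open Scope ring_scope.

(** N has a basis h, a_j, b_j (3 <= j <= n) with [h, b_j] = a_j the only nonzero
    brackets.  Invariants do not involve h, and they are the kernel of
    D = sum_j a_j d/db_j on k[a, b].  For two pairs (n = 4), the coefficient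
    recurrence D q = 0 shows that q is determined by its restriction to b_2 = 0,
    and that this restriction only has monomials with deg_(a_2) >= deg_(b_1),
    i.e. lies in k[a_1, a_2, a_2 b_1]; as a_2 b_1 is the restriction of the minor
    f = a_2 b_1 - a_1 b_2, the invariants are k[a_1, a_2, f].  For three pairs or
    more, the Pluecker relation sum +-a_i f_jl = 0 is a quadratic relation between
    elements which are independent in the cotangent space of Y(N) at the origin,
    which a polynomial ring does not allow.  The index is 2(n - 2) - 1, the rank
    of a form xi([x, y]) being 2 or 0. *)

(** * Derivations of polynomial rings and the chain rule *)

Lemma mderivXU (R : nzRingType) (n : nat) (i j : 'I_n) :
  ('X_i : {mpoly R[n]})^`M(j) = (i == j)%:R.
Proof.
rewrite mderivX mnm1E; case: eqP => [->|_]; last by rewrite scale0r.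
rewrite scale1r -mpolyX0; congr 'X_[_].
by apply/mnmP => l; rewrite mnmBE mnm0E subnn.
Qed.

Definition derivation (k : fieldType) (r : nat)
    (D : {mpoly k[r]} -> {mpoly k[r]}) : Prop :=
  linear D /\ forall p q, D (p * q) = D p * q + p * D q.

(** The chain rule. As functions of q, both sides are linear and obey the Leibniz rule along [phi],
    so agreement on the variables spreads to monomials and to all q. *)
Lemma derivation_lrmorphism (k : fieldType) (m r : nat)
    (phi : {lrmorphism {mpoly k[m]} -> {mpoly k[r]}})
    (D : {mpoly k[r]} -> {mpoly k[r]}) : derivation D ->
  forall q, D (phi q) = \sum_(i < m) phi q^`M(i) * D (phi 'X_i).
Proof.
move=> [Dlin DM].
pose l := GRing.isLinear.Build k {mpoly k[r]} {mpoly k[r]} _ D Dlin.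
pose D' : {linear {mpoly k[r]} -> {mpoly k[r]}} := HB.pack D l.
have D1 : D 1 = 0.
  have /eqP := DM 1 1; rewrite !mulr1 mul1r.
  by rewrite -subr_eq0 opprD addrA subrr sub0r oppr_eq0 => /eqP.
pose E q := \sum_(i < m) phi q^`M(i) * D (phi 'X_i).
have E1 : D (phi 1) = E 1.
  by rewrite rmorph1 D1 /E big1 // => i _; rewrite -mpolyC1 mderivC rmorph0 mul0r.
have EM p q : D (phi p) = E p -> D (phi q) = E q -> D (phi (p * q)) = E (p * q).
  move=> hp hq; rewrite rmorphM DM hp hq /E mulr_suml mulr_sumr -big_split /=.
  by apply: eq_bigr => i _; rewrite mderivM rmorphD !rmorphM /=; ring.
have EX i : D (phi 'X_i) = E 'X_i.
  rewrite /E (bigD1 i) //= big1 ?addr0 => [|j ji].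
    by rewrite mderivXU eqxx rmorph1 mul1r.
  by rewrite mderivXU eq_sym (negPf ji) rmorph0 mul0r.
have EXm (u : 'X_{1..m}) : D (phi 'X_[u]) = E 'X_[u].
  rewrite mpolyXE_id; apply: (big_ind (fun p => D (phi p) = E p)) => // i _.
  by elim: (u i) => [|e IH]; rewrite ?expr0 // exprS; apply: EM.
move=> q; rewrite -/(E q); elim/mpolyind: q => [|c u p _ _ IH].
  rewrite rmorph0 [LHS](linear0 D') /E big1 // => i _.
  by rewrite linear0 rmorph0 mul0r.
rewrite linearP Dlin EXm IH /E scaler_sumr -big_split; apply: eq_bigr => i _ /=.
by rewrite linearP linearP /= mulrDl scalerAl.
Qed.

Definition mdir (k : fieldType) (r : nat) (c : 'I_r -> k) (p : {mpoly k[r]}) :=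
  \sum_(i < r) c i *: p^`M(i).

Lemma mdir_derivation (k : fieldType) (r : nat) (c : 'I_r -> k) :
  derivation (mdir c).
Proof.
split=> [a p q|p q].
  rewrite /mdir scaler_sumr -big_split /=; apply: eq_bigr => i _.
  by rewrite linearP scalerDr !scalerA mulrC.
rewrite /mdir mulr_suml mulr_sumr -big_split /=; apply: eq_bigr => i _.
by rewrite mderivM scalerDr scalerAl scalerAr.
Qed.

HB.instance Definition _ (k : fieldType) (r : nat) (c : 'I_r -> k) :=
  GRing.isLinear.Build k {mpoly k[r]} {mpoly k[r]} _ (mdir c)
    (mdir_derivation c).1.

(** * Differentials on S(L), seen as the polynomial functions on the dual of L *)

Section SymmetricAlgebra.
Variables (k : fieldType) (L : lieAlgType k).
Implicit Types (x y : L) (xi : {linear L -> k^o}) (p q : symalg L).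

Lemma sym_ad_derivation x : derivation (@sym_ad k L x).
Proof. by split; [apply: sym_ad_is_linear | apply: sym_adM]. Qed.

(** A linear form is a tangent vector of the dual of L; this is the derivative along it, the
    derivation sending each x in L to the constant xi(x). *)
Definition sym_diff xi : symalg L -> symalg L :=
  mdir (fun i => xi (vbasis {:L})`_i : k).

Lemma sym_diff_derivation xi : derivation (sym_diff xi).
Proof. exact: mdir_derivation. Qed.

HB.instance Definition _ xi :=
  GRing.isLinear.Build k (symalg L) (symalg L) _ (sym_diff xi)
    (sym_diff_derivation xi).1.

Lemma sym_diffM xi p q :
  sym_diff xi (p * q) = sym_diff xi p * q + p * sym_diff xi q.
Proof. exact: (sym_diff_derivation xi).2. Qed.

Lemma sym_diff_inj xi x : sym_diff xi (sym_inj x) = (xi x)%:MP.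
Proof.
have dX i : (sym_inj x)^`M(i) = (coord (vbasis {:L}) i x)%:MP.
  rewrite /sym_inj raddf_sum (bigD1 i) //= big1 ?addr0 => [|j ji].
    by rewrite mderivZ mderivXU eqxx alg_mpolyC.
  by rewrite mderivZ mderivXU (negPf ji) scaler0.
rewrite {2}(coord_vbasis (memvf x)) (linear_sum xi) /sym_diff /mdir [RHS]raddf_sum.
apply: eq_bigr => i _; rewrite dX linearZ /= -mul_mpolyC -rmorphM /=.
by rewrite mulrC.
Qed.

Lemma sym_diffC xi c : sym_diff xi c%:MP = 0.
Proof.
by rewrite /sym_diff /mdir big1 // => i _; rewrite mderivC scaler0.
Qed.

Lemma mcoeff0_sym_inj x : (sym_inj x)@_0%MM = 0.
Proof.
rewrite /sym_inj raddf_sum big1 // => i _ /=.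
by rewrite mcoeffZ mcoeffX mnm1_eq0 mulr0.
Qed.

(* The coefficients of [sym_ad x] vanish at the origin, so differentiating    *)
(* [sym_ad x p = 0] there only sees the differential of [p].                  *)
Lemma invariant_diff0 x xi xi' p : sym_invariant p ->
  (forall y, xi' y = xi (lie x y)) -> (sym_diff xi' p)@_0%MM = 0.
Proof.
move=> /(_ x) inv xi'E.
have <- : (sym_diff xi (sym_ad x p))@_0%MM = 0 by rewrite inv linear0 mcoeff0.
rewrite /sym_ad (linear_sum (sym_diff xi)) [sym_diff xi' p]/sym_diff /mdir.
rewrite !raddf_sum /=; apply: eq_bigr => i _.
rewrite sym_diffM mcoeffD !rmorphM /= mcoeff0_sym_inj mul0r addr0.
by rewrite sym_diff_inj mcoeffC eqxx mulr1 mcoeffZ xi'E.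
Qed.

End SymmetricAlgebra.

(** * The obstruction to coregularity from three pairs *)

Section Relation.
Variables (k : fieldType) (L : lieAlgType k).

Lemma invariant_sym_inj (z : L) : (forall x, lie x z = 0) ->
  sym_invariant (sym_inj z).
Proof. by move=> cz x; rewrite sym_ad_inj cz linear0. Qed.

(** The same scalar c serves b and b', so [sym_ad x] sends both products to c a a' and the
    difference to 0. *)
Lemma invariant_minor (a a' b b' : L) :
    (forall x, lie x a = 0) -> (forall x, lie x a' = 0) ->
    (forall x, exists c : k, lie x b = c *: a /\ lie x b' = c *: a') ->
  sym_invariant (sym_inj a * sym_inj b' - sym_inj a' * sym_inj b).
Proof.
move=> ca ca' hb x; have [c [xb xb']] := hb x; have [lin dM] := sym_ad_derivation x.
pose l := GRing.isLinear.Build k (symalg L) (symalg L) _ (sym_ad x) lin.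
pose D : {linear symalg L -> symalg L} := HB.pack (sym_ad x) l.
rewrite [LHS](linearB D) /= !dM !sym_ad_inj ca ca' xb xb' !linearZ linear0 /=.
by rewrite !mul0r !add0r -!scalerAr mulrC subrr.
Qed.

(* The relation a_0 f_12 - a_1 f_02 + a_2 f_01 = 0 between the invariants     *)
(* a_i and f_ij = a_i b_j - a_j b_i would pull back along an isomorphism phi  *)
(* from a polynomial ring to one with nondegenerate quadratic part: dv and dw *)
(* are tangent vectors, at the point below the origin, which separate a_0 and *)
(* f_12 from the other four invariants; dw comes from a second derivative,    *)
(* and is tangent because the first derivative along beta kills invariants.   *)
Lemma not_coregular_minors (h : L) (a b : 3.-tuple L) :
    free a -> (forall x (i : 'I_3), lie x a`_i = 0) ->
    (forall x, exists c : k, forall i : 'I_3, lie x b`_i = c *: a`_i) ->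
    (forall i : 'I_3, lie h b`_i = a`_i) ->
  ~ coregular L.
Proof.
move=> fa ca cb hb [m [phi [phi_inj phiE]]].
pose i0 : 'I_3 := @Ordinal 3 0 isT; pose i1 : 'I_3 := @Ordinal 3 1 isT.
pose i2 : 'I_3 := @Ordinal 3 2 isT.
pose alpha (i : 'I_3) : {linear L -> k^o} := coord a i.
(* As alpha_2 composed with ad h, beta has the shape required by [invariant_diff0]; it kills every
   a_i, and among the b_i only b_2 has a nonzero value. *)
pose beta : {linear L -> k^o} := alpha i2 \o lie h.
have alphaE (i j : 'I_3) : alpha i a`_j = (j == i)%:R by rewrite -(coord_free j i fa).
have beta_a (i : 'I_3) : beta a`_i = 0 by rewrite /beta /= ca linear0.
have beta_b (i : 'I_3) : beta b`_i = (i == i2)%:R by rewrite /beta /= hb alphaE.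
pose minor (i j : 'I_3) : symalg L :=
  sym_inj a`_i * sym_inj b`_j - sym_inj a`_j * sym_inj b`_i.
have beta_minor i j : sym_diff beta (minor i j) =
    (j == i2)%:R *: sym_inj a`_i - (i == i2)%:R *: sym_inj a`_j.
  rewrite /minor linearB /= !sym_diffM !sym_diff_inj !beta_a !beta_b !rmorph0 !mul0r.
  by rewrite !add0r ![sym_inj _ * _]mulrC !mul_mpolyC.
have mkA (i : 'I_3) : exists q, phi q = sym_inj a`_i.
  by apply/phiE; apply: invariant_sym_inj => x; apply: ca.
have mkF (i j : 'I_3) : exists q, phi q = minor i j.
  apply/phiE; apply: invariant_minor => x; try exact: ca.
  by have [c cE] := cb x; exists c.
have [A0 A0E] := mkA i0; have [A1 A1E] := mkA i1; have [A2 A2E] := mkA i2.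
have [F01 F01E] := mkF i0 i1; have [F02 F02E] := mkF i0 i2.
have [F12 F12E] := mkF i1 i2.
have rel : A0 * F12 - A1 * F02 + A2 * F01 = 0.
  apply: phi_inj; rewrite rmorph0 rmorphD rmorphB !rmorphM /= F01E F02E F12E.
  by rewrite A0E A1E A2E /minor; ring.
pose ev q : k := (phi q)@_0%MM.
pose dv := mdir (fun l => (sym_diff (alpha i0) (phi 'X_l))@_0%MM).
pose dw :=
  mdir (fun l => (sym_diff (alpha i1) (sym_diff beta (phi 'X_l)))@_0%MM).
have ev_dv q : ev (dv q) = (sym_diff (alpha i0) (phi q))@_0%MM.
  rewrite (derivation_lrmorphism phi (sym_diff_derivation _)) /ev /dv !raddf_sum /=.
  by apply: eq_bigr => l _; rewrite linearZ mcoeffZ [RHS]rmorphM mulrC.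
have ev_dw q : ev (dw q) = (sym_diff (alpha i1) (sym_diff beta (phi q)))@_0%MM.
  rewrite (derivation_lrmorphism phi (sym_diff_derivation beta)).
  rewrite (linear_sum (sym_diff (alpha i1))).
  rewrite /ev /dw !raddf_sum /=; apply: eq_bigr => l _.
  rewrite linearZ sym_diffM mcoeffZ mcoeffD ![(_ * _)@_0%MM]rmorphM /=.
  rewrite (@invariant_diff0 _ _ h (alpha i2) beta) //; last by apply/phiE; exists 'X_l.
  by rewrite mulr0 add0r mulrC.
have ev_dw0 q i : phi q = sym_inj a`_i -> ev (dw q) = 0.
  by move=> qE; rewrite ev_dw qE sym_diff_inj sym_diffC mcoeff0.
have dvM p q : dv (p * q) = dv p * q + p * dv q.
  exact: (mdir_derivation _).2.
have dwM p q : dw (p * q) = dw p * q + p * dw q.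
  exact: (mdir_derivation _).2.
have dvD p q : dv (p + q) = dv p + dv q by apply: linearD.
have dvB p q : dv (p - q) = dv p - dv q by apply: linearB.
have dwD p q : dw (p + q) = dw p + dw q by apply: linearD.
have dwB p q : dw (p - q) = dw p - dw q by apply: linearB.
have evD p q : ev (p + q) = ev p + ev q by rewrite /ev !rmorphD.
have evB p q : ev (p - q) = ev p - ev q by rewrite /ev !rmorphB.
(* Of the four terms of the second-order Leibniz rule, three vanish at the origin, since A, F and
   [dw A] vanish there; dv A times dw F remains. *)
have dd A (i : 'I_3) F j l : phi A = sym_inj a`_i -> phi F = minor j l ->
    ev (dv (dw (A * F))) = (i == i0)%:R * ev (dw F).
  move=> AE FE; have ev0A : ev A = 0 by rewrite /ev AE mcoeff0_sym_inj.
  have ev0F : ev F = 0.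
    by rewrite /ev FE mcoeffB !rmorphM /= !mcoeff0_sym_inj mul0r subr0.
  have evM p q : ev (p * q) = ev p * ev q by rewrite /ev !rmorphM.
  rewrite dwM dvD !dvM !evD !evM.
  rewrite ev0A ev0F (ev_dw0 _ _ AE) !(mulr0, mul0r, add0r, addr0).
  by rewrite ev_dv AE sym_diff_inj alphaE mcoeffC eqxx mulr1.
have : ev (dv (dw (A0 * F12 - A1 * F02 + A2 * F01))) = 0.
  by rewrite rel /dw /dv !linear0 /ev rmorph0 mcoeff0.
rewrite dwD dwB dvD dvB evD evB (dd A0 i0 F12 i1 i2) // (dd A1 i1 F02 i0 i2) //.
rewrite (dd A2 i2 F01 i0 i1) //.
(* The surviving term is dw F12 = alpha_1(a_1) = 1, whereas the relation makes the sum 0. *)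
rewrite mul1r !mul0r subr0 addr0 ev_dw F12E beta_minor eqxx scale1r scale0r subr0.
rewrite sym_diff_inj alphaE mcoeffC !eqxx mulr1 => /eqP.
by rewrite oner_eq0.
Qed.
End Relation.

(** * Monomial maps and coefficient extraction *)

Lemma lrmorphism_mpolyX (k : fieldType) (r s : nat)
    (f : {lrmorphism {mpoly k[r]} -> {mpoly k[s]}}) (u : 'X_{1..r}) :
  f 'X_[u] = \prod_(i < r) f 'X_i ^+ u i.
Proof.
by rewrite mpolyXE_id rmorph_prod; apply: eq_bigr => i _; rewrite rmorphXn.
Qed.

Section MonomialMap.
Variables (k : fieldType) (r s : nat).
Variables (psi : {lrmorphism {mpoly k[r]} -> {mpoly k[s]}}).
Variable (tau : 'X_{1..r} -> 'X_{1..s}).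
Hypotheses (psiX : forall u, psi 'X_[u] = 'X_[tau u]).

Lemma monomial_mapE p : psi p = \sum_(u <- msupp p) p@_u *: 'X_[tau u].
Proof.
rewrite {1}(mpolyE p) linear_sum; apply: eq_bigr => u _.
by rewrite linearZ /= psiX.
Qed.

Lemma monomial_map_inj : injective tau -> injective psi.
Proof.
move=> tau_inj; apply: raddf_inj => p p0; have {}p0 : psi p = 0 := p0.
apply/mpolyP => u.
rewrite mcoeff0 -[RHS](mcoeff0 k (tau u)) -p0 monomial_mapE {1}(mpolyE p).
rewrite !raddf_sum; apply: eq_bigr => v _.
by rewrite /= !mcoeffZ !mcoeffX (inj_eq tau_inj).
Qed.

Lemma monomial_map_image q :
  (forall u, q@_u != 0 -> exists v, tau v = u) -> exists p, psi p = q.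
Proof.
rewrite {2}(mpolyE q) => h; have {}h u : u \in msupp q -> exists v, tau v = u.
  by rewrite mcoeff_msupp; apply: h.
elim: (msupp q) h => [|u us IH] h; first by exists 0; rewrite big_nil rmorph0.
have [p pE] := IH (fun v vus => h v (mem_behead (s := u :: us) vus)).
have [v vE] := h u (mem_head _ _); exists (q@_u *: 'X_[v] + p).
rewrite big_cons linearP; congr (_ *: _ + _) => //.
by rewrite -[in RHS]vE; apply: psiX.
Qed.
End MonomialMap.

Lemma diagonal_map_coeff (k : fieldType) (r : nat)
    (rho : {lrmorphism {mpoly k[r]} -> {mpoly k[r]}}) (c : 'X_{1..r} -> k) :
    (forall u, rho 'X_[u] = c u *: 'X_[u]) ->
  forall q u, (rho q)@_u = c u * q@_u.
Proof.
move=> rhoX q u; rewrite {1}(mpolyE q) linear_sum raddf_sum.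
rewrite [in RHS](mpolyE q) raddf_sum mulr_sumr.
apply: eq_bigr => v _; rewrite linearZ /= rhoX !mcoeffZ mcoeffX.
by case: eqP => [->|_]; rewrite ?mulr0 // !mulr1 mulrC.
Qed.

(** The indicator covers the case [u i = 0], in which the subtraction of multi-indices is truncated
    and the coefficient on the right would be the wrong one. *)
Lemma mcoeffXM (R : nzRingType) (r : nat) (i : 'I_r) (p : {mpoly R[r]})
    (u : 'X_{1..r}) :
  (p * 'X_i)@_u = (0 < u i)%N%:R * p@_(u - U_(i)).
Proof.
have [ui|ui] := posnP (u i).
  rewrite mul0r {1}(mpolyE p) mulr_suml raddf_sum big1 // => v _ /=.
  rewrite -scalerAl -mpolyXD mcoeffZ mcoeffX; case: eqP => [e|]; rewrite ?mulr0 //.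
  by move: ui; rewrite -e mnmDE mnm1E eqxx addn1.
by rewrite mul1r -[in LHS](submK (_ : (U_(i) <= u)%MM)) 1?addmC ?mcoeffMX ?lep1mP -?lt0n.
Qed.

(** The derivative has coefficient [u i] times [p@_u] at [u - U_(i)], and a positive integer is
    invertible in characteristic zero. *)
Lemma mderiv_eq0 (k : fieldType) (r : nat) (i : 'I_r) (p : {mpoly k[r]})
    (u : 'X_{1..r}) :
  [pchar k] =i pred0 -> p^`M(i) = 0 -> (0 < u i)%N -> p@_u = 0.
Proof.
move=> /pcharf0P ch p0 ui.
have : (p^`M(i))@_(u - U_(i)) = 0 by rewrite p0 mcoeff0.
rewrite mcoeff_mderiv submK ?lep1mP -?lt0n //.
by move/eqP; rewrite -mulr_natr mulf_eq0 ch orbF => /eqP.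
Qed.

(** * Invariants in the coordinates of a chosen basis *)

Section ChangeOfBasis.
Variables (k : fieldType) (L : lieAlgType k) (r : nat) (X : r.-tuple L).

(** [symalg] is written in the unspecified basis [vbasis]; this substitution allows computing with
    variables that stand for the members of [X]. *)
Definition basis_poly : {lrmorphism {mpoly k[r]} -> {mpoly k[\dim {:L}]}} :=
  comp_mpoly [tuple sym_inj X`_i | i < r].

Lemma basis_polyX i : basis_poly 'X_i = sym_inj X`_i.
Proof.
by rewrite /basis_poly /= comp_mpolyXU -[LHS]tnth_nth tnth_mktuple.
Qed.

Lemma invariantB (p q : symalg L) :
  sym_invariant p -> sym_invariant q -> sym_invariant (p - q).
Proof.
move=> inv_p inv_q x; rewrite -scaleN1r addrC.
by rewrite sym_ad_is_linear inv_p inv_q scaler0 addr0.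
Qed.

Lemma invariant_lrmorphism (m : nat)
    (phi : {lrmorphism {mpoly k[m]} -> {mpoly k[\dim {:L}]}}) :
  (forall i, sym_invariant (phi 'X_i)) -> forall p, sym_invariant (phi p).
Proof.
move=> phi_inv p x; rewrite (derivation_lrmorphism _ (sym_ad_derivation x)).
by rewrite big1 // => i _; rewrite phi_inv mulr0.
Qed.

Lemma sym_ad_basis x q : sym_ad x (basis_poly q) =
  \sum_(j < r) basis_poly q^`M(j) * sym_inj (lie x X`_j).
Proof.
rewrite (derivation_lrmorphism _ (sym_ad_derivation x)); apply: eq_bigr => j _.
by rewrite basis_polyX sym_ad_inj.
Qed.

Hypothesis hX : basis_of {:L} X.

Lemma lie_basis x y : lie x y = \sum_(j < r) coord X j x *: lie X`_j y.
Proof.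
rewrite lieC {1}(coord_basis hX (memvf x)) linear_sum -sumrN.
by apply: eq_bigr => j _; rewrite linearZ /= -scalerN -lieC.
Qed.

(** The inverse replaces each variable by the expansion of its [vbasis] vector in [X]; both
    composites fix the variables. *)
Lemma basis_poly_bij : bijective basis_poly.
Proof.
pose c x : {mpoly k[r]} := \sum_(l < r) coord X l x *: 'X_l.
pose g : {lrmorphism {mpoly k[\dim {:L}]} -> {mpoly k[r]}} :=
  comp_mpoly [tuple c (vbasis {:L})`_i | i < \dim {:L}].
have gX i : g 'X_i = c (vbasis {:L})`_i.
  by rewrite /g /= comp_mpolyXU -[LHS]tnth_nth tnth_mktuple.
have g_inj x : g (sym_inj x) = c x.
  rewrite /sym_inj raddf_sum {2}(coord_vbasis (memvf x)) /c /=.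
  under [RHS]eq_bigr do rewrite linear_sum scaler_suml.
  rewrite exchange_big /=; apply: eq_bigr => i _.
  rewrite linearZ /= gX /c scaler_sumr; apply: eq_bigr => l _.
  by rewrite scalerA [in RHS]linearZ.
have basis_c x : basis_poly (c x) = sym_inj x.
  rewrite raddf_sum {2}(coord_basis hX (memvf x)) linear_sum /=.
  by apply: eq_bigr => l _; rewrite !linearZ /= basis_polyX.
have mpoly_id (s : nat) (f : {lrmorphism {mpoly k[s]} -> {mpoly k[s]}}) :
    (forall i, f 'X_i = 'X_i) -> f =1 id.
  move=> fX p; rewrite (mpolyE p) linear_sum; apply: eq_bigr => u _.
  rewrite linearZ /= mpolyXE_id rmorph_prod; congr (_ *: _).
  by apply: eq_bigr => i _; rewrite rmorphXn /= fX.
exists g => p.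
  apply: (mpoly_id _ (g \o basis_poly)) => i /=.
  rewrite basis_polyX g_inj /c (bigD1 i) //= coord_free ?(basis_free hX) // eqxx.
  rewrite scale1r big1 ?addr0 // => j ji.
  by rewrite coord_free ?(basis_free hX) // eq_sym (negPf ji) scale0r.
apply: (mpoly_id _ (basis_poly \o g)) => i /=.
rewrite gX basis_c /sym_inj (bigD1 i) //=.
rewrite coord_free ?(basis_free (vbasisP _)) // eqxx.
rewrite scale1r big1 ?addr0 // => j ji.
by rewrite coord_free ?(basis_free (vbasisP _)) // eq_sym (negPf ji) scale0r.
Qed.

(** Invariance needs checking on generators only, because the chain rule extends it to every
    polynomial in them. *)
Lemma coregular_basis (m : nat) (phi : {lrmorphism {mpoly k[m]} -> {mpoly k[r]}}) :
    injective phi ->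
    (forall i, sym_invariant (basis_poly (phi 'X_i))) ->
    (forall q, sym_invariant (basis_poly q) -> exists p, phi p = q) ->
  coregular L.
Proof.
move=> phi_inj phi_inv phi_surj; have [g basisK gK] := basis_poly_bij.
exists m, (basis_poly \o phi); split=> [p q /(can_inj basisK)/phi_inj //|p].
split=> [inv_p|[q <-] x].
  by have [|q qE] := phi_surj (g p); [rewrite gK | exists q; rewrite /= qE gK].
exact: (invariant_lrmorphism (phi := basis_poly \o phi)).
Qed.

End ChangeOfBasis.

(** * The kernel of D = a d/db + a' d/db' *)

Section MinorDerivation.
Variables (k : fieldType) (r : nat) (a a' b b' : 'I_r) (q : {mpoly k[r]}).
Hypotheses (ch : [pchar k] =i pred0) (dis : uniq [:: a; a'; b; b']).
Hypothesis (dq : q^`M(b) * 'X_a + q^`M(b') * 'X_a' = 0).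

Let dis_eq : ((a == a' = false) * (a == b = false) * (a == b' = false) *
  (a' == b = false) * (a' == b' = false) * (b == b' = false))%type.
Proof.
move: dis; rewrite /= !inE !negb_or !andbT.
by case/andP=> /and3P[??? /andP[/andP[??] ?]]; do !split; apply: negPf.
Qed.

Let swap (a0 b0 : 'I_r) (u : 'X_{1..r}) : (0 < u b0)%N ->
  (u - U_(b0) + U_(a0) - U_(a0) + U_(b0) = u)%MM.
Proof. by move=> ub; rewrite addmK submK // lep1mP -lt0n. Qed.

(** The recurrence read off from D q = 0 at [u]: it links the coefficients of q at u - a + b and u -
    a' + b', and an indicator drops a term whose subtraction is truncated. *)
Let coeff_dq (u : 'X_{1..r}) : (0 < u a)%N%:R * (q@_(u - U_(a) + U_(b)) *+ (u b).+1) +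
  (0 < u a')%N%:R * (q@_(u - U_(a') + U_(b')) *+ (u b').+1) = 0.
Proof.
have := congr1 (mcoeff u) dq; rewrite mcoeff0 mcoeffD !mcoeffXM !mcoeff_mderiv.
by rewrite !mnmBE !mnm1E !dis_eq !subn0.
Qed.

Let mulrSn_eq0 (c : k) n : (c *+ n.+1 == 0) = (c == 0).
Proof. by have /pcharf0P p0 := ch; rewrite -mulr_natr mulf_eq0 p0 orbF. Qed.

(** Induction on the exponent of a'. The recurrence at u - b + a ties the coefficient at u to one
    where a' and b both have one exponent less, so b still exceeds a'; when a' has exponent 0 that
    other term is absent. *)
Lemma minor_kernel_support (u : 'X_{1..r}) : q@_u != 0 -> (u b <= u a')%N.
Proof.
rewrite leqNgt; apply: contraNN => ub.
elim: {u}(u a') {-2}u (erefl (u a')) ub => [|n IH] u ua' ub;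
  have := coeff_dq (u - U_(b) + U_(a))%MM;
  rewrite swap ?(leq_trans _ ub) // !mnmDE !mnmBE !mnm1E eqxx addn1 mul1r.
  by rewrite eq_sym !dis_eq ua' mul0r addr0 => /eqP; rewrite mulrSn_eq0.
rewrite [q@_(_ + U_(b'))](eqP (IH _ _ _)).
- by rewrite mul0rn mulr0 addr0 => /eqP; rewrite mulrSn_eq0.
- rewrite !(mnmDE, mnmBE, mnm1E) !eqxx [b == a']eq_sym [b' == a']eq_sym !dis_eq.
  by rewrite ua'; lia.
rewrite !(mnmDE, mnmBE, mnm1E) !eqxx [b == a']eq_sym [b' == a']eq_sym.
rewrite [b' == b]eq_sym !dis_eq.
by move: ub; lia.
Qed.

(** Induction on the exponent of b': the recurrence at u - b' + a' expresses the coefficient at u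
    through one with a smaller exponent of b'. *)
Lemma minor_kernel_eq0 : (forall u : 'X_{1..r}, u b' = 0%N -> q@_u = 0) -> q = 0.
Proof.
move=> q0; apply/mpolyP => u; rewrite mcoeff0.
elim: {u}(u b') {-2}u (erefl (u b')) => [|n IH] u ub; first exact: q0.
have := coeff_dq (u - U_(b') + U_(a'))%MM.
rewrite swap ?ub // [q@_(_ + U_(b))]IH; last first.
  rewrite !(mnmDE, mnmBE, mnm1E) eqxx !dis_eq ub; lia.
rewrite mul0rn mulr0 add0r !(mnmDE, mnmBE, mnm1E) eqxx addn1 mul1r => /eqP.
by rewrite mulrSn_eq0 => /eqP.
Qed.
End MinorDerivation.

(** * Coregularity with one pair and with two pairs *)

Section SmallCases.
Variables (k : fieldType) (L : lieAlgType k).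
Hypothesis ch : [pchar k] =i pred0.

(** In the basis h, a, b the invariants are k[a]: ad h is a d/db and ad b is -a d/dh, and a is not a
    zero divisor, so an invariant involves neither b nor h. *)
Lemma coregular_heisenberg (X : 3.-tuple L) : basis_of {:L} X ->
    (forall x, lie x X`_1 = 0) -> lie X`_0 X`_2 = X`_1 ->
  coregular L.
Proof.
move=> hX ca hb; pose T := basis_poly X.
have T_inj : injective T := bij_inj (basis_poly_bij hX).
pose h : 'I_3 := @Ordinal 3 0 isT; pose a : 'I_3 := @Ordinal 3 1 isT.
pose b : 'I_3 := @Ordinal 3 2 isT.
pose phi : {lrmorphism {mpoly k[1]} -> {mpoly k[3]}} :=
  comp_mpoly [tuple 'X_a : {mpoly k[3]}].
pose tau (u : 'X_{1..1}) : 'X_{1..3} := (U_(a) *+ u ord0)%MM.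
have phiX u : phi 'X_[u] = 'X_[tau u].
  by rewrite /phi /= comp_mpolyX big_ord1 mpolyXn.
have a0 : T 'X_a != 0.
  by rewrite -(rmorph0 T) (inj_eq T_inj) -msupp_eq0 msuppX.
have TXa : T 'X_a = sym_inj X`_1 := basis_polyX X a.
have sum3 (V : nmodType) (F : 'I_3 -> V) : \sum_(i < 3) F i = F h + F a + F b.
  by rewrite !big_ord_recr big_ord0 [LHS]/= add0r; congr (F _ + F _ + F _); apply: val_inj.
have adE x q : sym_ad x (T q) = T q^`M(h) * sym_inj (lie x X`_0) +
    T q^`M(a) * sym_inj (lie x X`_1) + T q^`M(b) * sym_inj (lie x X`_2).
  rewrite sym_ad_basis; exact: sum3.
apply: (coregular_basis hX (phi := phi)).
- apply: (monomial_map_inj phiX) => u v /mnmP/(_ a).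
  rewrite !mulmnE mnm1E eqxx !mul1n => uv; apply/mnmP => i.
  by rewrite (ord1 i).
- move=> i; rewrite /phi /= comp_mpolyXU (ord1 i) /=.
  by rewrite -/T TXa; apply: invariant_sym_inj.
move=> q inv; apply: (monomial_map_image phiX) => u qu.
exists [multinom u a | _ < 1].
have qb : q^`M(b) = 0.
  have := inv X`_0; rewrite adE liexx ca hb !linear0 !mulr0 !add0r.
  rewrite -TXa => /eqP; rewrite mulf_eq0 (negPf a0) orbF => /eqP e.
  by apply: T_inj; rewrite rmorph0.
have qh : q^`M(h) = 0.
  have := inv X`_2; rewrite adE liexx ca [lie _ _]lieC hb !linear0 !mulr0 !addr0.
  rewrite linearN /= -TXa mulrN => /eqP.
  rewrite oppr_eq0 mulf_eq0 (negPf a0) orbF => /eqP e.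
  by apply: T_inj; rewrite rmorph0.
apply/mnmP => i; rewrite mulmnE mnm1E mnmE.
have zero (j : 'I_3) : q^`M(j) = 0 -> u j = 0%N.
  move=> qj; apply/eqP; rewrite -leqn0 leqNgt; apply: contraNN qu => uj.
  by rewrite (mderiv_eq0 ch qj).
have ord3 (j : 'I_3) : [\/ j = h, j = a | j = b].
  by case: j => [[|[|[|//]]] lt];
    [constructor 1 | constructor 2 | constructor 3]; apply: val_inj.
by case: (ord3 i) => ->; rewrite /= ?mul0n ?mul1n // zero.
Qed.

(** The basis is h, a, a', b, b'. Everything is compared after [rho]: [rho \o phi] is an injective
    monomial map, its image contains [rho q] for each invariant q, and an invariant killed by [rho]
    is 0. *)
Lemma coregular_two_pairs (X : 5.-tuple L) : basis_of {:L} X ->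
    (forall x, lie x X`_1 = 0) -> (forall x, lie x X`_2 = 0) ->
    lie X`_0 X`_3 = X`_1 -> lie X`_0 X`_4 = X`_2 -> lie X`_3 X`_4 = 0 ->
  coregular L.
Proof.
move=> hX ca ca' hb hb' bb'; pose T := basis_poly X.
have T_inj : injective T := bij_inj (basis_poly_bij hX).
pose h : 'I_5 := @Ordinal 5 0 isT; pose a : 'I_5 := @Ordinal 5 1 isT.
pose a' : 'I_5 := @Ordinal 5 2 isT; pose b : 'I_5 := @Ordinal 5 3 isT.
pose b' : 'I_5 := @Ordinal 5 4 isT.
have sum5 (V : nmodType) (F : 'I_5 -> V) :
    \sum_(i < 5) F i = F h + F a + F a' + F b + F b'.
  rewrite !big_ord_recr big_ord0 [LHS]/= add0r.
  by congr (F _ + F _ + F _ + F _ + F _); apply: val_inj.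
have prod5 (R : nzRingType) (F : 'I_5 -> R) :
    \prod_(i < 5) F i = F h * F a * F a' * F b * F b'.
  rewrite !big_ord_recr big_ord0 [LHS]/= mul1r.
  by congr (F _ * F _ * F _ * F _ * F _); apply: val_inj.
pose minor : {mpoly k[5]} := 'X_a' * 'X_b - 'X_a * 'X_b'.
pose phi : {lrmorphism {mpoly k[3]} -> {mpoly k[5]}} :=
  comp_mpoly [tuple 'X_a; 'X_a'; minor].
(* [rho] restricts to h = b' = 0, where [minor] becomes a monomial. *)
pose rho : {lrmorphism {mpoly k[5]} -> {mpoly k[5]}} :=
  comp_mpoly [tuple 0; 'X_a; 'X_a'; 'X_b; 0].
pose o0 : 'I_3 := @Ordinal 3 0 isT; pose o1 : 'I_3 := @Ordinal 3 1 isT.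
pose o2 : 'I_3 := @Ordinal 3 2 isT.
(* The third variable goes to a' b under [rho \o phi], so its exponent counts for both a' and b. *)
pose tau (u : 'X_{1..3}) : 'X_{1..5} :=
  (U_(a) *+ u o0 + U_(a') *+ (u o1 + u o2) + U_(b) *+ u o2)%MM.
have phi0 : phi 'X_o0 = 'X_a by rewrite /phi /= comp_mpolyXU.
have phi1 : phi 'X_o1 = 'X_a' by rewrite /phi /= comp_mpolyXU.
have phi2 : phi 'X_o2 = minor by rewrite /phi /= comp_mpolyXU.
have rhoa : rho 'X_a = 'X_a by rewrite /rho /= comp_mpolyXU.
have rhoa' : rho 'X_a' = 'X_a' by rewrite /rho /= comp_mpolyXU.
have rhob : rho 'X_b = 'X_b by rewrite /rho /= comp_mpolyXU.
have rhoh : rho 'X_h = 0 by rewrite /rho /= comp_mpolyXU.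
have rhob' : rho 'X_b' = 0 by rewrite /rho /= comp_mpolyXU.
have rhominor : rho minor = 'X_a' * 'X_b.
  by rewrite /minor rmorphB !rmorphM /= rhoa rhoa' rhob rhob' mulr0 subr0.
have prod3 (R : nzRingType) (F : 'I_3 -> R) :
    \prod_(i < 3) F i = F o0 * F o1 * F o2.
  rewrite !big_ord_recr big_ord0 [LHS]/= mul1r.
  by congr (F _ * F _ * F _); apply: val_inj.
have rhophiX u : (rho \o phi) 'X_[u] = 'X_[tau u].
  rewrite lrmorphism_mpolyX prod3 /= phi0 phi1 phi2 rhoa rhoa' rhominor.
  rewrite exprMn mulrA -[_ * _ * 'X_a' ^+ _]mulrA.
  by rewrite -exprD /tau !mpolyXD !mpolyXn.
have dtau u : (tau u h = 0)%N * (tau u a = u o0)%N * (tau u a' = u o1 + u o2)%N *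
    (tau u b = u o2)%N * (tau u b' = 0)%N.
  by rewrite /tau !mnmDE !mulmnE !mnm1E /= !mul0n !mul1n !addn0.
have rhoX (u : 'X_{1..5}) :
    rho 'X_[u] = ((u h == 0%N) && (u b' == 0%N))%:R *: 'X_[u].
  rewrite lrmorphism_mpolyX [in RHS]mpolyXE_id !prod5 rhoh rhoa rhoa' rhob rhob' !expr0n.
  by do 2 case: eqP => [->|_]; rewrite ?expr0 ?scale1r ?scale0r ?(mul0r, mulr0).
have rhoE := diagonal_map_coeff rhoX.
have ca0 y : lie X`_1 y = 0 by rewrite lieC ca oppr0.
have ca0' y : lie X`_2 y = 0 by rewrite lieC ca' oppr0.
have b'b : lie X`_4 X`_3 = 0 by rewrite lieC bb' oppr0.
have bX x : exists c : k, lie x X`_4 = c *: X`_2 /\ lie x X`_3 = c *: X`_1.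
  exists (coord X h x); rewrite !(lie_basis hX x) !sum5 /= hb hb' bb' b'b.
  by rewrite !ca0 !ca0' !liexx !scaler0 !addr0.
have adE x q : sym_ad x (T q) =
    T q^`M(h) * sym_inj (lie x X`_0) + T q^`M(a) * sym_inj (lie x X`_1) +
    T q^`M(a') * sym_inj (lie x X`_2) + T q^`M(b) * sym_inj (lie x X`_3) +
    T q^`M(b') * sym_inj (lie x X`_4).
  by rewrite sym_ad_basis; apply: sum5.
have TXa : T 'X_a = sym_inj X`_1 := basis_polyX X a.
have TXa' : T 'X_a' = sym_inj X`_2 := basis_polyX X a'.
have TXb : T 'X_b = sym_inj X`_3 := basis_polyX X b.
have TXb' : T 'X_b' = sym_inj X`_4 := basis_polyX X b'.
have ord3 (i : 'I_3) : [\/ i = o0, i = o1 | i = o2].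
  by case: i => [[|[|[|//]]] lt];
    [constructor 1 | constructor 2 | constructor 3]; apply: val_inj.
have ord5 (i : 'I_5) : [\/ i = h \/ i = a, i = a' | i = b \/ i = b'].
  by case: i => [[|[|[|[|[|//]]]]] lt]; [constructor 1; left | constructor 1; right
    | constructor 2 | constructor 3; left | constructor 3; right]; apply: val_inj.
have inv_phi i : sym_invariant (T (phi 'X_i)).
  have [->|->|->] := ord3 i.
  - by rewrite phi0 TXa; apply: invariant_sym_inj.
  - by rewrite phi1 TXa'; apply: invariant_sym_inj.
  rewrite phi2 /minor rmorphB !rmorphM /= TXa TXa' TXb TXb'.
  exact: invariant_minor.
have Xa0 : ('X_a : {mpoly k[5]}) != 0 by rewrite -msupp_eq0 msuppX.
(* Invariance under b reads -a dq/dh = 0, and invariance under h reads D q = 0. *)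
have inv_eqs q : sym_invariant (T q) ->
    q^`M(h) = 0 /\ q^`M(b) * 'X_a + q^`M(b') * 'X_a' = 0.
  move=> inv; split; apply: (T_inj); rewrite rmorph0.
    have := inv X`_3; rewrite adE ca ca' liexx bb' [lie _ _]lieC hb linear0.
    rewrite !mulr0 !addr0 linearN /= -TXa mulrN => /eqP.
    rewrite oppr_eq0 mulf_eq0 -(rmorph0 T) !(inj_eq T_inj).
    by case/orP => [/eqP->|e] //; case/negP: Xa0.
  have := inv X`_0; rewrite adE ca ca' liexx hb hb' linear0 !mulr0 !add0r.
  by rewrite -TXa -TXa' rmorphD !rmorphM.
apply: (coregular_basis hX (phi := phi)) => // [|q inv_q].
  have : injective (rho \o phi).
    apply: (monomial_map_inj rhophiX) => u v uv; apply/mnmP => i.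
    have := (congr1 (fun w : 'X_{1..5} => (w a, w a', w b)) uv).
    rewrite !dtau => -[e0 e1 e2].
    have [->|->|->] := ord3 i; lia.
  exact: inj_compr.
have [qh qD] := inv_eqs q inv_q.
have [|p pE] := monomial_map_image rhophiX (q := rho q).
  move=> u; rewrite rhoE; case: andP => [[/eqP uh /eqP ub']|_]; last first.
    by rewrite mul0r eqxx.
  rewrite mul1r => /(minor_kernel_support ch (isT : uniq [:: a; a'; b; b']) qD) ub.
  (* The truncated difference is a true one by the support bound [u b <= u a'], so [tau] maps this
     exponent to [u]. *)
  exists [multinom tnth [tuple u a; (u a' - u b)%N; u b] i | i < 3].
  apply/mnmP => i; have [[]|->|[]] := ord5 i => [->|->||->|->]; rewrite dtau ?uh ?ub' // !mnmE //=.
  by rewrite !(tnth_nth 0%N) /= subnK.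
have rpE : rho (phi p) = rho q := pE.
exists p; apply/eqP; rewrite -subr_eq0; apply/eqP.
have inv_r : sym_invariant (T (phi p - q)).
  have inv_p := @invariant_lrmorphism _ _ _ (T \o phi) inv_phi p.
  by rewrite (rmorphB T); exact: (invariantB inv_p inv_q).
have [rh rD] := inv_eqs _ inv_r.
apply: (minor_kernel_eq0 ch (isT : uniq [:: a; a'; b; b']) rD) => u ub'.
have [uh|uh] := posnP (u h); last exact: (mderiv_eq0 ch rh).
have : (rho (phi p - q))@_u = 0 by rewrite (rmorphB rho) /= rpE subrr mcoeff0.
by rewrite rhoE uh ub' mul1r.
Qed.
End SmallCases.

(** * The index as an attained minimum *)

Section Index.
Variables (k : fieldType) (L : lieAlgType k).

Lemma lie_index_le (xi : 'Hom(L, k^o)) : (lie_index L <= \dim (form_radical xi))%N.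
Proof.
by rewrite /lie_index; case: ex_minnP => d _; apply; apply/asboolP; exists xi.
Qed.

Lemma lie_index_attained :
  exists xi : 'Hom(L, k^o), \dim (form_radical xi) = lie_index L.
Proof. by rewrite /lie_index; case: ex_minnP => d /asboolP. Qed.
End Index.

(** * Elementary matrices, brackets and index of N *)

Section Nil112.
Variables (k : fieldType) (m : nat).
Local Notation n := m.+3.
Local Notation N := (subLie (@nil112_subalg k n)).
Implicit Types (x y : N) (s : seq (nat * nat)).

(* Matrix indices start at 0; [inord] sends an index out of range to 0.       *)
Definition in112 (ij : nat * nat) : bool :=
  [&& (ij.1 < 2)%N, (ij.1 < ij.2)%N & (ij.2 < n)%N].

Definition nilE (ij : nat * nat) : N :=
  vsproj (nil112 k n) (delta_mx (inord ij.1) (inord ij.2)).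

Definition entry (i j : nat) (x : N) : k^o :=
  (vsval x : 'M[k]_n) (inord i) (inord j).

Lemma entry_is_linear i j : linear (entry i j).
Proof. by move=> c x y; rewrite /entry linearP !mxE. Qed.

HB.instance Definition _ i j :=
  GRing.isLinear.Build k N k^o _ (entry i j) (entry_is_linear i j).

Lemma entry_inj x y : (forall i j, in112 (i, j) -> entry i j x = entry i j y) ->
  x = y.
Proof.
move=> xy; apply: subvs_inj; apply/matrixP => i j.
have [ij|ij] := boolP ((i < 2) && (i < j))%N; last first.
  have [/elem_spanP x0 /elem_spanP y0] := (subvsP x, subvsP y).
  by rewrite x0 ?y0.
have := xy i j; rewrite /entry !inord_val; apply.
by case/andP: ij => i2 ij; rewrite /in112 /= i2 ij ltn_ord.
Qed.

Lemma entry_nilE i j ij : in112 ij -> (i < n)%N -> (j < n)%N ->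
  entry i j (nilE ij) = (ij == (i, j))%:R.
Proof.
case: ij => a b /and3P[/= a2 ab bn] i_n jn; have an := ltn_trans ab bn.
rewrite /entry /nilE vsprojK ?mxE; last first.
  apply/elem_spanP => i' j' ij'; rewrite mxE.
  case: eqP => [ei|//]; case: eqP => [ej|//]; move: ij'.
  by rewrite ei ej !inordK //= a2 ab.
rewrite -!val_eqE /= !inordK // xpair_eqE [i == a]eq_sym [j == b]eq_sym.
by case: eqP; case: eqP.
Qed.

(** Stated for an arbitrary list of positions, so that it serves both for the basis of N and for
    bounding a radical from above. *)
Lemma nilE_span s x : (forall i j, in112 (i, j) -> entry i j x != 0 -> (i, j) \in s) ->
  x \in <<map nilE s>>%VS.
Proof.
move=> xs; rewrite -[x]vsvalK (matrix_sum_delta (vsval x)) !linear_sum.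
apply: rpred_sum => i _; rewrite linear_sum; apply: rpred_sum => j _.
rewrite linearZ /=; have [->|xij] := eqVneq ((vsval x : 'M[k]_n) i j) 0.
  by rewrite scale0r rpred0.
apply: rpredZ; apply: memv_span; apply/mapP; exists (val i, val j).
  apply: xs; last by rewrite /entry !inord_val.
  rewrite /in112 /= ltn_ord andbT; apply: contraR xij => ij.
  by have /elem_spanP -> := subvsP x.
by rewrite /nilE /= !inord_val.
Qed.

Lemma nilE_free s : all in112 s -> uniq s -> free (map nilE s).
Proof.
elim: s => [|[i j] s IH] /=; first by rewrite nil_free.
case/andP=> ij s112 /andP[nij us]; have /and3P[/= i2 lij jn] := ij.
have i_n := ltn_trans lij jn; rewrite free_cons IH // andbT.
apply/negP => h; have /subvP/(_ _ h) : (<<map nilE s>> <= lker (linfun (entry i j)))%VS.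
  apply/span_subvP => _ /mapP[ab abs ->]; rewrite memv_ker lfunE /=.
  rewrite entry_nilE //; last exact: allP abs.
  by case: (ab =P _) => // e; rewrite -e abs in nij.
by rewrite memv_ker lfunE /= entry_nilE // eqxx oner_eq0.
Qed.

(** In a product of two elements of N, a nonzero term through l needs i < l < 2, which leaves only i
    = 0 and l = 1. *)
Lemma entry_lie x y i j : in112 (i, j) -> entry i j (lie x y) =
  (i == 0%N)%:R * (entry 0 1 x * entry 1 j y - entry 0 1 y * entry 1 j x).
Proof.
move=> /and3P[/= i2 ij jn]; have i_n := ltn_trans ij jn.
have mulE (u v : N) : ((vsval u : 'M[k]_n) *m vsval v) (inord i) (inord j) =
    (i == 0%N)%:R * (entry 0 1 u * entry 1 j v).
  have /elem_spanP u0 := subvsP u; have /elem_spanP v0 := subvsP v.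
  rewrite mxE (bigD1 (inord 1)) //= big1 ?addr0 => [|l l1].
    have [->|i0] := eqVneq i 0%N; first by rewrite mul1r.
    by rewrite u0 ?mul0r // !inordK //; move: i2 i0; lia.
  have {}l1 : (l : nat) <> 1%N.
    by move=> e; move/eqP: l1; apply; apply: val_inj; rewrite /= inordK.
  have [l2|l2] := boolP ((l < 2) && (l < j))%N; last by rewrite v0 ?mulr0 // inordK.
  by rewrite u0 ?mul0r // inordK //; move: l2 l1; lia.
by rewrite {1}/entry vsval_lie mx_lieE mxE [X in _ + X]mxE !mulE mulrBr.
Qed.

Lemma nilE_basis s : all in112 s -> uniq s ->
  (forall ij, in112 ij -> ij \in s) -> basis_of {:N} (map nilE s).
Proof.
move=> s112 us sN; rewrite /basis_of nilE_free // andbT eqEsubv subvf.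
by apply/subvP => x _; apply: nilE_span => i j ij _; apply: sN.
Qed.

(** Elements with zero h-coordinate commute with each other, so only the h-part of x acts on y. *)
Lemma lie_col0 x y : entry 0 1 y = 0 ->
  lie x y = (entry 0 1 x : k) *: (lie (nilE (0, 1)%N) y : N).
Proof.
move=> y01; apply: entry_inj => i l il; rewrite linearZ /= !entry_lie // y01.
by rewrite !mul0r !subr0 entry_nilE // eqxx mul1r mulrCA.
Qed.

Lemma lie_nilE0 x j : (1 < j < n)%N -> lie x (nilE (0, j)) = 0.
Proof.
case/andP=> j1 jn; have j112 : in112 (0, j) by rewrite /in112 /= jn ltnW.
apply: entry_inj => i l il; have /and3P[/= _ _ ln] := il.
rewrite entry_lie // !entry_nilE // linear0 !xpair_eqE /= (gtn_eqF j1).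
by rewrite !mulr0 mul0r subr0 mulr0.
Qed.

Lemma lie_nilE1 x j : (1 < j < n)%N ->
  lie x (nilE (1, j)) = (entry 0 1 x : k) *: nilE (0, j).
Proof.
case/andP=> j1 jn; have j112 : in112 (1, j) by rewrite /in112 /= jn j1.
have j112' : in112 (0, j) by rewrite /in112 /= jn ltnW.
apply: entry_inj => i l il; have /and3P[/= i2 lil ln] := il.
rewrite linearZ /= entry_lie // !entry_nilE //; last exact: ltn_trans ln.
rewrite !xpair_eqE /= mul0r subr0 [0%N == i]eq_sym.
case: (i == 0%N); case: (j == l); rewrite /= ?mul1r ?mul0r ?mulr0 ?scaler0 //.
Qed.

(** The form dual to E_02 (indices from 0) suffices: pairing with E_12 and E_01 forces the entries
    (0,1) and (1,2) of its radical to vanish. *)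
Lemma lie_index_small : (n <= 4)%N -> (lie_index N <= 3)%N.
Proof.
move=> n4; pose xi : 'Hom(N, k^o) := linfun (entry 0 2).
apply: leq_trans (lie_index_le xi) _.
(* For n = 3 the positions with column 3 are out of range, but the bound only uses the length of
   this list. *)
pose s : seq (nat * nat) := [:: (0, 2); (0, 3); (1, 3)].
apply: (@leq_trans (\dim <<map nilE s>>%VS)); last exact: dim_span.
apply/dimvS/subvP => x /mem_form_radical radx; apply: nilE_span => i j ij.
have x01 : entry 0 1 x = 0.
  have := radx (nilE (1, 2)); rewrite lfunE /= lie_nilE1 // linearZ /=.
  by rewrite entry_nilE // => /eqP; rewrite -[_ *: _]/(_ * _) mulr1 => /eqP.
have x12 : entry 1 2 x = 0.
  have := radx (nilE (0, 1)); rewrite lfunE /= entry_lie // !entry_nilE //.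
  by rewrite x01 !mul0r mul1r sub0r => /eqP; rewrite mul1r oppr_eq0 => /eqP.
case/and3P: ij => /=; case: i j => [|[|//]] [|[|[|[|j]]]] //= _ _ jn.
- by rewrite x01 eqxx.
- by move: jn n4; lia.
- by rewrite x12 eqxx.
by move: jn n4; lia.
Qed.

(** On a 5-dimensional space of commuting elements with zero h-coordinate, the single linear
    condition xi([h, x]) = 0 puts x in the radical, which therefore has dimension at least 4 for
    every xi. *)
Lemma lie_index_large : (4 < n)%N -> (3 < lie_index N)%N.
Proof.
move=> n4; have [xi <-] := lie_index_attained N.
pose s : seq (nat * nat) := [:: (0, 2); (0, 3); (0, 4); (1, 2); (1, 3)].
pose h := nilE (0, 1)%N; pose f : 'Hom(N, k^o) := lie_form xi h.
have dU : \dim <<map nilE s>>%VS = 5%N.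
  by apply/eqP/nilE_free => //=; rewrite /in112 /=; lia.
have := limg_ker_dim f <<map nilE s>>%VS; rewrite dU => dUf.
have f1 : (\dim (f @: <<map nilE s>>) <= 1)%N.
  by apply: leq_trans (dimvS (subvf _)) _; rewrite dimvf.
apply: (@leq_trans (\dim (<<map nilE s>> :&: lker f))); first by move: dUf f1; lia.
apply/dimvS/subvP => x; rewrite memv_cap memv_ker => /andP[xU /eqP fx].
apply/mem_form_radical => y; rewrite lieC linearN.
have x01 : entry 0 1 x = 0.
  have /subvP/(_ _ xU) : (<<map nilE s>> <= lker (linfun (entry 0 1)))%VS.
    apply/span_subvP => _ /mapP[ab abs ->]; rewrite memv_ker lfunE /= entry_nilE //.
      by move: abs; rewrite !inE => /or4P[|||/orP[]] /eqP ->.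
    by move: abs; rewrite !inE /in112 => /or4P[|||/orP[]] /eqP -> /=; lia.
  by rewrite memv_ker lfunE => /eqP.
rewrite lie_col0 // linearZ /= -[xi _](lie_formE xi h) fx.
by rewrite scaler0 oppr0.
Qed.
End Nil112.

(** * Coregularity of N according to n *)

Section NilCoregular.
Variables (k : fieldType) (m : nat).
Local Notation n := m.+3.
Local Notation N := (subLie (@nil112_subalg k n)).

Lemma nil112_not_coregular : (4 < n)%N -> ~ coregular N.
Proof.
move=> n4; pose E := @nilE k m.
(* Column 4, counted from 0, exists because n is at least 5; this gives the third pair. *)
pose a : 3.-tuple N := [tuple E (0, 2)%N; E (0, 3)%N; E (0, 4)%N].
pose b : 3.-tuple N := [tuple E (1, 2)%N; E (1, 3)%N; E (1, 4)%N].
have aE (i : 'I_3) : a`_i = E (0, i.+2)%N by case: i => [[|[|[|]]]].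
have bE (i : 'I_3) : b`_i = E (1, i.+2)%N by case: i => [[|[|[|]]]].
have i_n (i : 'I_3) : (1 < i.+2 < n)%N by have := ltn_ord i; move: n4; lia.
apply: (@not_coregular_minors k N (E (0, 1)%N) a b) => [|x i|x|i].
- apply: (@nilE_free k m [:: (0, 2); (0, 3); (0, 4)]%N) => //=.
  by rewrite /in112 /=; lia.
- by rewrite aE lie_nilE0.
- by exists (entry 0 1 x) => i; rewrite aE bE lie_nilE1.
by rewrite aE bE lie_nilE1 // entry_nilE // scale1r.
Qed.

Lemma nil112_coregular : [pchar k] =i pred0 -> (n <= 4)%N -> coregular N.
Proof.
move=> ch; case: m => [|[|//]] _.
  apply: (@coregular_heisenberg k (subLie (@nil112_subalg k 3)) ch
    [tuple nilE k 0 (0, 1); nilE k 0 (0, 2); nilE k 0 (1, 2)]%N) => [|x|] /=.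
  - apply: (@nilE_basis k 0 [:: (0, 1); (0, 2); (1, 2)]%N) => //.
    by case=> [[|[|i]] [|[|[|j]]]].
  - exact: lie_nilE0.
  by rewrite lie_nilE1 // entry_nilE // scale1r.
apply: (@coregular_two_pairs k (subLie (@nil112_subalg k 4)) ch
  [tuple nilE k 1 (0, 1); nilE k 1 (0, 2); nilE k 1 (0, 3); nilE k 1 (1, 2);
         nilE k 1 (1, 3)]%N) => [|x|x|||] /=.
- apply: (@nilE_basis k 1 [:: (0, 1); (0, 2); (0, 3); (1, 2); (1, 3)]%N) => //.
  by case=> [[|[|i]] [|[|[|[|j]]]]].
- exact: lie_nilE0.
- exact: lie_nilE0.
- by rewrite lie_nilE1 // entry_nilE // scale1r.
- by rewrite lie_nilE1 // entry_nilE // scale1r.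
by rewrite lie_nilE1 // entry_nilE // scale0r.
Qed.
End NilCoregular.

Theorem proposition28 (k : closedFieldType) (n : nat)
    (hk : [pchar k] =i pred0) (hn : (3 <= n)%N) :
  let N : lieAlgType k := subLie (@nil112_subalg k n) in
  (coregular N <-> (n <= 4)%N) /\ ((n <= 4)%N <-> (lie_index N <= 3)%N).
Proof.
case: n hn => [|[|[|m]]] // _ N; split; split.
- by rewrite leqNgt => cN; apply/negP => /(@nil112_not_coregular k m).
- exact: nil112_coregular.
- exact: lie_index_small.
by rewrite leqNgt => iN; rewrite leqNgt; apply: contra iN; apply: lie_index_large.
Qed.
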